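(* For every unit quaternion $q_e=[q_{ev}^\top,q_{e4}]^\top\in\mathbb{Q}_a$, $$-\ln q_{e4}^2\le\frac{1-q_{e4}^2}{|q_{e4}|}.$$
   Context: $\mathbb{Q}_a=\{q_e=[q_{ev}^\top,q_{e4}]^\top\in\mathbb{R}^3\times\mathbb{R}\mid q_{ev}^\top q_{ev}+q_{e4}^2=1,\ q_{e4}\neq0\}$. *)

(* Defs.v *)
From mathcomp Require Import all_boot all_order all_algebra.
From mathcomp Require Import classical_sets reals.

Import Order.TTheory GRing.Theory Num.Theory.
Local Open Scope classical_set_scope.
Local Open Scope ring_scope.

(* A quaternion is the pair of its vector part [q.1], a column vector, and its
   scalar part [q.2]. The product [q.1^T *m q.1] is a 1 x 1 matrix, whence the
   projection [0 0]. *)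
Definition Qa (R : realType) : set ('cV[R]_3 * R) :=
  [set q | (q.1^T *m q.1) 0 0 + q.2 ^+ 2 = 1 /\ q.2 != 0].

(* Main.v *)
(** On [Qa] the scalar part satisfies [0 < |q4| <= 1]. With [t := - ln |q4| >= 0]
    the inequality reads [2 t <= e^t - e^(-t)], whose two sides agree at [0]
    and whose difference has derivative [e^t + e^(-t) - 2 >= 0]. *)

Require Import Defs.
From mathcomp Require Import all_boot all_order all_algebra.
From mathcomp Require Import classical_sets reals exp.
From mathcomp Require Import sequences topology normedtype derive realfun.
From mathcomp Require Import lra.

Import Order.TTheory GRing.Theory Num.Theory.
Import numFieldNormedType.Exports.
Local Open Scope ring_scope.

(** The square of [q.2] is 1 minus a sum of squares. *)
Lemma Qa_norm_scalar_le1 (R : realType) (q : 'cV[R]_3 * R) :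
  Qa R q -> `|q.2| <= 1.
Proof.
move=> [q1 _]; rewrite -(@expr_le1 _ 2) // real_normK ?num_real// -q1 lerDr.
by rewrite mxE sumr_ge0// => i _; rewrite mxE -expr2 sqr_ge0.
Qed.

Lemma double_le_expRB (R : realType) (t : R) :
  0 <= t -> 2 * t <= expR t - expR (- t).
Proof.
move=> t0; pose f (x : R) := expR x - expR (- x) - 2 * x.
have df (x : R) : is_derive x 1 f (expR x + expR (- x) - 2).
  have dN : is_derive x 1 (fun y : R => expR (- y)) (expR (- x) * -1).
    exact: is_derive1_comp.
  by apply: is_derive_eq; rewrite mulrN1 opprK scaler1.
have cf : {within `[0, t], continuous f}%classic.
  by apply: derivable_within_continuous => x _; exact: ex_derive.
have [c _] := MVT_segment t0 (fun x _ => df x) cf.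
(* As [f 0 = 0], the mean value theorem gives [f t] as [t] times the derivative at [c]. *)
rewrite /f oppr0 subrr mulr0 !subr0 addr0 -subr_ge0 => ->.
rewrite mulr_ge0//.
(* Adding the tangent bounds at [c] and [- c] cancels the linear terms and leaves 2. *)
have := expR_ge1Dx c; have := expR_ge1Dx (- c); lra.
Qed.

Theorem lemma1 (R : realType) (qev : 'cV[R]_3) (qe4 : R)
    (hq : Qa R (qev, qe4)) :
  - ln (qe4 ^+ 2) <= (1 - qe4 ^+ 2) / `|qe4|.
Proof.
have x1 : `|qe4| <= 1 := @Qa_norm_scalar_le1 R (qev, qe4) hq.
have x0 : 0 < `|qe4| by rewrite normr_gt0; case: hq.
(* Both sides depend on [qe4] only through its absolute value. *)
rewrite -(real_normK (num_real qe4)); move: `|qe4| x0 x1 => x x0 x1.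
have := @double_le_expRB R (- ln x); rewrite oppr_ge0 ln_le0// => /(_ isT).
(* The right-hand side is [x^-1 - x], with [x^-1 = expR (- ln x)]. *)
rewrite opprK expRN lnK ?posrE// lnXn// mulrN mulr_natl mulrBl mul1r.
by rewrite expr2 mulfK ?gt_eqF.
Qed.
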